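(* Let $\ell\in\mathbb{N}$ and let $v(x)=\sum_{j=1}^{\ell}a_jx^{2j-1}$ be an odd real polynomial ($a_1,\dots,a_\ell\in\mathbb{R}$). Then for every non-principal ultrafilter $p\in\beta\mathbb{N}$, $$\operatorname{p_\ell-lim}_{n\in\mathbb{N}} v(n)=0 \quad\text{in } \mathbb{T}=\mathbb{R}/\mathbb{Z}.$$ Equivalently, for every $\epsilon>0$ the set $\mathcal R(v,\epsilon)=\{n\in\mathbb{N}\,:\,\|v(n)\|<\epsilon\}$ is a $\Delta_\ell^*$ set.
   Context: $\mathbb{N}=\{1,2,\dots\}$ and $\|x\|$ denotes the distance from $x\in\mathbb{R}$ to the nearest integer; $v(n)$ is regarded as an element of $\mathbb{T}=\mathbb{R}/\mathbb{Z}$. $\beta\mathbb{N}$ is the set of ultrafilters on $\mathbb{N}$. For a non-principal ultrafilter $p$, $-p+p$ is the ultrafilter defined by: $A\in -p+p$ iff $\{n\in\mathbb{N}: n+A\in p\}\in p$, where $n+A=\{n+a:a\in A\}$. Set $p_0=p$ and $p_\ell=-p_{\ell-1}+p_{\ell-1}$ for $\ell\ge1$. For a sequence $(x_n)$ in a compact Hausdorff space $X$, $\operatorname{p-lim}_{n} x_n=x$ means that for every neighbourhood $U$ of $x$, $\{n: x_n\in U\}\in p$. Define $\partial:\bigcup_{\ell\ge1}\mathbb{Z}^{2^\ell}\to\mathbb{Z}$ recursively by $\partial(m_1,m_2)=m_2-m_1$ and $\partial(m_1,\dots,m_{2^\ell})=\partial(m_{2^{\ell-1}+1},\dots,m_{2^\ell})-\partial(m_1,\dots,m_{2^{\ell-1}})$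 for $\ell>1$. A set $E\subseteq\mathbb{N}$ is $\Delta_\ell^*$ if for every increasing sequence $(n_k)_{k\in\mathbb{N}}$ in $\mathbb{N}$ there exist $k_1<k_2<\dots<k_{2^\ell}$ with $\partial(n_{k_1},\dots,n_{k_{2^\ell}})\in E$. *)

(* Defs.v *)
From HB Require Import structures.
From mathcomp Require Import all_boot all_order all_algebra.
From mathcomp Require Import all_classical all_reals all_analysis.

Set Implicit Arguments.
Unset Strict Implicit.
Unset Printing Implicit Defensive.

Import Order.TTheory GRing.Theory Num.Theory.
Import numFieldNormedType.Exports.
Local Open Scope classical_set_scope.
Local Open Scope ring_scope.
Local Open Scope quotient_scope.

Notation posnat := {n : nat | (0 < n)%N}.

Definition translate (n : posnat) (A : set posnat) : set posnat :=
  [set m | exists2 a, A a & val m = (val n + val a)%N].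

(* The ultrafilter -p+p, for p a nonprincipal ultrafilter. *)
Definition self_diff (p : set_system posnat) : set_system posnat :=
  [set A | p [set n | p (translate n A)]].

Definition iter_diff (l : nat) (p : set_system posnat) : set_system posnat :=
  iter l self_diff p.

Definition nonprincipal (p : set_system posnat) : Prop :=
  ~ exists n, p = principal_filter n.

Definition RmodZ (R : realType) :=
  {ideal_quot (GRing.ZmodClosed.clone R (@Num.int_num_subdef R) _)}.

(* R/Z, with the quotient topology of R. *)
Definition circle (R : realType) : topologicalType :=
  quotient_topology (RmodZ R).

Definition to_circle (R : realType) (x : R) : circle R :=
  \pi_(quotient_topology (RmodZ R)) x.

Lemma to_circleP (R : realType) (x y : R) :
  to_circle x = to_circle y <-> x - y \is a Num.int.
Proof.
have -> : (x - y \is a Num.int) = (x == y %[mod RmodZ R]).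
  by rewrite -Quotient.idealrBE.
by split => [e|/eqP e]; [apply/eqP|]; exact: e.
Qed.

Definition dist_int (R : realType) (x : R) : R :=
  inf [set `|x - m%:~R| | m in [set: int]].

Definition odd_polynomial (R : realType) (l : nat) (a : nat -> R) : {poly R} :=
  \sum_(1 <= j < l.+1) a j *: 'X^(2 * j - 1).

(* The alternating map on Z^(2^l), meaningful when size m = 2 ^ l. The
   convention for l = 0 makes the l = 1 case [:: m1; m2] |-> m2 - m1. *)
Fixpoint partial_diff (l : nat) (m : seq int) : int :=
  if l is l'.+1 then
    partial_diff l' (drop (2 ^ l') m) - partial_diff l' (take (2 ^ l') m)
  else head 0 m.

Definition Delta_star (l : nat) (E : set posnat) : Prop :=
  forall n : nat -> posnat,
    {homo n : i j / (i < j)%N >-> (val i < val j)%N} ->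
    exists k : (2 ^ l).-tuple nat,
      sorted ltn k /\
      exists2 e, E e &
        (val e)%:Z = partial_diff l [seq (val (n i))%:Z | i <- k].

(* Main.v *)
Require Import Defs.
From HB Require Import structures.
From mathcomp Require Import all_boot all_order all_algebra.
From mathcomp Require Import all_classical all_reals all_analysis.
From mathcomp Require Import lra zify.

Set Implicit Arguments.
Unset Strict Implicit.
Unset Printing Implicit Defensive.

Import Order.TTheory GRing.Theory Num.Theory.
Import numFieldNormedType.Exports.
Local Open Scope classical_set_scope.
Local Open Scope ring_scope.

(** A limit along [- p + p] is an iterated limit along [p], first in [m] and
then in [n], of values at [m - n].  Expand [c (m - n) ^ d] with [d] odd.  The
outer terms [c m ^ d] and [c n ^ d] have the same limit in [R/Z], which exists
by compactness, so they cancel.  In a cross term [c' m ^ i n ^ j] exactly one of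
[i], [j] is odd, and it is at most [d - 2].  If it is [i], the limit in [m]
vanishes by induction on the number of difference steps; if it is [j], the limit
in [m] is [x n ^ j] for some real [x], and the limit in [n] vanishes.

For the combinatorial form, the image of a free ultrafilter under [k |-> n_k] is
a nonprincipal [p], and membership in [p_l] unfolds into [2 ^ l] successive
choices of indices, each as large as we please. *)

Lemma ultra_of_setVsetC (T : Type) (F : set_system T) :
  ProperFilter F -> (forall A, F A \/ F (~` A)) -> UltraFilter F.
Proof.
move=> PF FVC; split=> // G PG FG; rewrite eqEsubset; split=> // A GA.
have [//|/FG GAC] := FVC A.
by have [x []] := filter_ex (filterI GA GAC).
Qed.

Lemma fmap_ultra (T U : Type) (F : set_system T) (f : T -> U) :
  UltraFilter F -> UltraFilter (f @ F).
Proof.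
move=> UF; apply: ultra_of_setVsetC => A.
exact: (in_ultra_setVsetC (f @^-1` A) UF).
Qed.

Lemma ultra_set1_principal (T : Type) (F : set_system T) (x : T) :
  UltraFilter F -> F [set x] -> F = principal_filter x.
Proof.
move=> UF Fx; apply: (@max_filter _ _ (principal_filter_ultra x)).
by move=> A /principal_filterP Ax; apply: filterS Fx => _ ->.
Qed.

Section fubini_product.
Variables (T U : Type).

Definition fubini_prod (F : set_system T) (G : set_system U) :
    set_system (T * U) :=
  [set A | \forall x \near F, \forall y \near G, A (x, y)].

Variables (F : set_system T) (G : set_system U).

Global Instance fubini_prod_filter :
  Filter F -> Filter G -> Filter (fubini_prod F G).
Proof.
move=> FF FG; split=> [|A B|A B AB]; rewrite /fubini_prod /=.
- by apply: nearW => x; exact: nearW.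
- by apply: filterS2 => x; exact: filterI.
- by apply: filterS => x; apply: filterS => y; exact: AB.
Qed.

Global Instance fubini_prod_proper_filter :
  ProperFilter F -> ProperFilter G -> ProperFilter (fubini_prod F G).
Proof.
move=> PF PG; apply: Build_ProperFilter_ex => A FA.
by have [x /filter_ex[y Axy]] := @filter_ex _ F _ _ FA; exists (x, y).
Qed.

Lemma fubini_prod_ultra :
  UltraFilter F -> UltraFilter G -> UltraFilter (fubini_prod F G).
Proof.
move=> UF UG; apply: ultra_of_setVsetC => A; rewrite /fubini_prod /=.
have [|FA] := in_ultra_setVsetC [set x | G [set y | A (x, y)]] UF.
  by left.
right; apply: filterS FA => x /= GA.
by have [] := in_ultra_setVsetC [set y | A (x, y)] UG.
Qed.

Lemma cvg_fubini_prod (X : topologicalType) (f : T -> U -> X) (g : T -> X)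
    (z : X) : Filter F -> Filter G ->
  (\forall x \near F, f x y @[y --> G] --> g x) -> g @ F --> z ->
  f xy.1 xy.2 @[xy --> fubini_prod F G] --> z.
Proof.
move=> FF FG fg gz V; rewrite nbhsE => -[W [oW Wz] WV].
have gW : \forall x \near F, W (g x) by apply: gz; exact: open_nbhs_nbhs.
apply: (@filterS2 _ F) fg gW => x fgx /(conj oW)/open_nbhs_nbhs/fgx.
by apply: filterS => y; exact: WV.
Qed.

End fubini_product.

Section dist_int.
Variable R : realType.
Implicit Types x y e : R.

Lemma dist_int_ltP x e :
  dist_int x < e <-> exists m : int, `|x - m%:~R| < e.
Proof.
split=> [xe|[m xm]].
  by have [|_ [m _ <-] xm] := inf_lt _ xe; [exists `|x - 0%:~R|, 0|exists m].
apply: le_lt_trans xm; apply: ge_inf; last by exists m.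
by exists 0 => _ [k _ <-].
Qed.

Lemma dist_intN x : dist_int (- x) = dist_int x.
Proof.
by congr inf; apply/seteqP; split=> _ [m _ <-]; exists (- m) => //;
  rewrite mulrNz -normrN opprD !opprK.
Qed.

Lemma ler_dist_intD x y : dist_int (x + y) <= dist_int x + dist_int y.
Proof.
apply/ler_addgt0Pr => e e0; have e20 : 0 < e / 2 by lra.
have /dist_int_ltP[m xm] : dist_int x < dist_int x + e / 2 by rewrite ltrDl.
have /dist_int_ltP[k yk] : dist_int y < dist_int y + e / 2 by rewrite ltrDl.
apply/ltW/dist_int_ltP; exists (m + k).
rewrite intrD opprD addrACA; apply: le_lt_trans (ler_normD _ _) _; lra.
Qed.

End dist_int.

Section circle.
Variable R : realType.
Implicit Types x y : R.

Lemma to_circle_continuous : continuous (@to_circle R).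
Proof. exact: pi_continuous. Qed.

Lemma to_circleB_int x (m : int) : to_circle (x - m%:~R) = to_circle x.
Proof. by apply/to_circleP; rewrite addrAC subrr sub0r rpredN intr_int. Qed.

Lemma to_circle_open (A : set R) : open A -> open (@to_circle R @` A).
Proof.
move=> oA; rewrite /open /= /quotient_open.
have -> : @to_circle R @^-1` (@to_circle R @` A) =
    \bigcup_(m : int) ((fun x => x - m%:~R) @^-1` A).
  apply/seteqP; split=> x.
    move=> [y Ay /to_circleP/intrP[m yxm]]; exists (- m) => //=.
    by rewrite mulrNz opprK -yxm addrC subrK.
  by move=> [m _ Axm]; exists (x - m%:~R) => //; exact: to_circleB_int.
apply: bigcup_open => m _; apply: open_comp => // x _.
by apply: cvgB; [exact: cvg_id|exact: cvg_cst].
Qed.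

Lemma to_circle_unit_itv : @to_circle R @` `[0, 1] = setT.
Proof.
rewrite -subTset => z _; elim/quotW: z => x.
exists (x - (Num.floor x)%:~R); last exact: to_circleB_int.
by have := floor_itv x; rewrite /= in_itv /= intrD; lra.
Qed.

Lemma circle_compact : compact [set: circle R].
Proof.
rewrite -to_circle_unit_itv; apply: continuous_compact (@segment_compact R 0 1).
exact: continuous_subspaceT to_circle_continuous.
Qed.

Lemma ultra_cvg_to_circle (T : Type) (F : set_system T) (f : T -> R) :
  UltraFilter F -> exists x, to_circle (f t) @[t --> F] --> to_circle x.
Proof.
move=> UF; have := circle_compact; rewrite compact_ultra.
move=> /(_ _ (fmap_ultra (@to_circle R \o f) UF)) [|z [_ Fz]].
  exact: (@filterT _ F).
by move: z Fz; elim/quotW => x Fx; exists x.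
Qed.

Section limits.
Variables (T : Type) (F : set_system T).
Context {FF : Filter F}.
Implicit Types f g : T -> R.

Lemma cvg_to_circleP f x :
  to_circle (f t) @[t --> F] --> to_circle x <->
  forall eps : R, 0 < eps -> \forall t \near F, dist_int (f t - x) < eps.
Proof.
split=> [fx eps eps0|fx V /to_circle_continuous/nbhs_ballP[eps /= eps0 epsV]].
  have : nbhs (to_circle x) (@to_circle R @` ball x eps).
    apply: open_nbhs_nbhs; split; first exact/to_circle_open/ball_open.
    by exists x => //; exact: ballxx.
  move=> /fx; apply: (@filterS _ F) => t [y xy /to_circleP/intrP[m yfm]].
  apply/dist_int_ltP; exists (- m); rewrite mulrNz opprK -yfm.
  by rewrite addrC addrA subrK distrC.
apply: filterS (fx _ eps0) => t /dist_int_ltP[m fm] /=.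
by rewrite -(to_circleB_int _ m); apply: epsV; rewrite /ball /= distrC addrAC.
Qed.

Lemma cvg_to_circleN f x : to_circle (f t) @[t --> F] --> to_circle x ->
  to_circle (- f t) @[t --> F] --> to_circle (- x).
Proof.
move=> /cvg_to_circleP fx; apply/cvg_to_circleP => eps /fx.
by apply: filterS => t; rewrite -opprD dist_intN.
Qed.

Lemma cvg_to_circleD f g x y :
  to_circle (f t) @[t --> F] --> to_circle x ->
  to_circle (g t) @[t --> F] --> to_circle y ->
  to_circle (f t + g t) @[t --> F] --> to_circle (x + y).
Proof.
move=> /cvg_to_circleP fx /cvg_to_circleP gy; apply/cvg_to_circleP => eps eps0.
have eps20 : 0 < eps / 2 by lra.
apply: filterS2 (fx _ eps20) (gy _ eps20) => t ftx gty.
rewrite opprD addrACA [eps]splitr.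
exact: le_lt_trans (ler_dist_intD _ _) (ltrD ftx gty).
Qed.

Lemma cvg_to_circleB f g x y :
  to_circle (f t) @[t --> F] --> to_circle x ->
  to_circle (g t) @[t --> F] --> to_circle y ->
  to_circle (f t - g t) @[t --> F] --> to_circle (x - y).
Proof. by move=> fx /cvg_to_circleN; exact: cvg_to_circleD. Qed.

Lemma cvg_to_circle_sum (I : Type) (s : seq I) (P : pred I) (f : I -> T -> R)
    (x : I -> R) :
  (forall i, P i -> to_circle (f i t) @[t --> F] --> to_circle (x i)) ->
  to_circle (\sum_(i <- s | P i) f i t) @[t --> F]
    --> to_circle (\sum_(i <- s | P i) x i).
Proof.
move=> fx; elim: s => [|i s IH].
  by under eq_cvg do rewrite big_nil; rewrite big_nil; exact: cvg_cst.
under eq_cvg do rewrite big_cons; rewrite big_cons; case: ifPn => // Pi.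
exact: cvg_to_circleD (fx i Pi) IH.
Qed.

Lemma cvg_to_circleMn f x k : to_circle (f t) @[t --> F] --> to_circle x ->
  to_circle (f t *+ k) @[t --> F] --> to_circle (x *+ k).
Proof.
move=> fx; elim: k => [|k IH]; first exact: cvg_cst.
by rewrite mulrS; under eq_cvg do rewrite mulrS; exact: cvg_to_circleD.
Qed.

End limits.

Lemma fubini_prod_to_circleB (T : Type) (F : set_system T) (f : T -> R) :
  UltraFilter F ->
  to_circle (f xy.2 - f xy.1) @[xy --> fubini_prod F F] --> to_circle (0 : R).
Proof.
move=> UF; have [x Fx] := ultra_cvg_to_circle f UF.
apply: (@cvg_fubini_prod _ _ _ _ _ (fun s t => to_circle (f t - f s))
  (fun s => to_circle (x - f s))).
  by apply: nearW => s; apply: cvg_to_circleB => //; exact: cvg_cst.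
by rewrite -(subrr x); apply: cvg_to_circleB => //; exact: cvg_cst.
Qed.

End circle.

Section self_difference.
Implicit Types (p : set_system posnat) (m n : posnat).

(* Equal to the junk value [m] unless [n < m]. *)
Definition posnat_sub m n : posnat := insubd m (val m - val n)%N.

Lemma val_posnat_sub m n :
  (val n < val m)%N -> val (posnat_sub m n) = (val m - val n)%N.
Proof. by move=> nm; rewrite val_insubd subn_gt0 nm. Qed.

Lemma translateE n m (A : set posnat) :
  (val n < val m)%N -> translate n A m <-> A (posnat_sub m n).
Proof.
move=> nm; split=> [[a Aa mna]|Amn].
  suff -> : posnat_sub m n = a by [].
  by apply: val_inj; rewrite val_posnat_sub// mna addKn.
by exists (posnat_sub m n) => //; rewrite val_posnat_sub// subnKC// ltnW.
Qed.

Lemma nonprincipalP p : UltraFilter p ->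
  nonprincipal p <-> val n @[n --> p] --> \oo.
Proof.
move=> Up; split=> [np|/cvgnyPgt py [k pk]]; last first.
  by have := py (val k); rewrite pk => /principal_filterP; rewrite ltnn.
apply/cvgnyPgt; elim=> [|K IH]; first by apply: nearW => -[].
pose k : posnat := exist _ K.+1 (ltn0Sn K).
have [/(ultra_set1_principal Up) pk|pk] := in_ultra_setVsetC [set k] Up.
  by case: np; exists k.
apply: filterS2 IH pk => n Kn nk; rewrite ltn_neqAle Kn andbT.
by apply/eqP => Kn'; apply: nk; apply: val_inj.
Qed.

Lemma near_fubini_prod_ltn p : Filter p -> val n @[n --> p] --> \oo ->
  \forall nm \near fubini_prod p p, (val nm.1 < val nm.2)%N.
Proof. by move=> Fp /cvgnyPgt py; apply: (@nearW _ p) => n; exact: py. Qed.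

Lemma self_diffE p : Filter p -> val n @[n --> p] --> \oo ->
  self_diff p = posnat_sub nm.2 nm.1 @[nm --> fubini_prod p p].
Proof.
move=> Fp /cvgnyPgt py; apply/seteqP; split=> A; apply: (@filterS _ p) => n;
  by apply: (@filterS2 _ p) (py (val n)) => m nm; rewrite /= translateE.
Qed.

Lemma self_diff_ultra p : UltraFilter p -> nonprincipal p ->
  UltraFilter (self_diff p).
Proof.
move=> Up /nonprincipalP py; rewrite self_diffE//.
exact/fmap_ultra/fubini_prod_ultra.
Qed.

Lemma self_diff_nonprincipal p : UltraFilter p -> nonprincipal p ->
  nonprincipal (self_diff p).
Proof.
move=> Up np; have Ud := self_diff_ultra Up np; apply/nonprincipalP.
have /nonprincipalP py := np; apply/cvgnyPgt => K; rewrite self_diffE//.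
have /cvgnyPgt pgt := py; apply: (@nearW _ p) => n.
by apply: filterS (pgt (val n + K)%N) => m nKm; rewrite /= val_posnat_sub; lia.
Qed.

Lemma iter_diff_ultra_nonprincipal l p : UltraFilter p -> nonprincipal p ->
  UltraFilter (iter_diff l p) /\ nonprincipal (iter_diff l p).
Proof.
move=> Up np; elim: l => [//|l [Uq nq]].
by split; [exact: self_diff_ultra|exact: self_diff_nonprincipal].
Qed.

End self_difference.

Lemma exprB_odd (R : comPzRingType) (x y : R) d : odd d ->
  (x - y) ^+ d = x ^+ d - y ^+ d +
    \sum_(1 <= i < d) (-1) ^+ i * x ^+ (d - i) * y ^+ i *+ 'C(d, i).
Proof.
move=> od; have d0 : (0 < d)%N by exact: odd_gt0.
rewrite exprBn -(big_mkord xpredT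
  (fun i => (-1) ^+ i * x ^+ (d - i) * y ^+ i *+ 'C(d, i))).
rewrite big_nat_recr//= big_ltn// subn0 subnn bin0 binn !expr0 -signr_odd od.
by rewrite expr1 mul1r !mulr1 mulN1r !mulr1n addrAC.
Qed.

Section odd_powers.
Variable R : realType.
Implicit Types (p : set_system posnat) (c : R).

Definition odd_powers_vanish l p : Prop :=
  forall c d, odd d -> (d < l.*2)%N ->
    to_circle (c * (val n)%:R ^+ d) @[n --> p] --> to_circle (0 : R).

Lemma cross_term_vanish l p c i j :
  UltraFilter p -> odd_powers_vanish l p ->
  odd (i + j) -> (0 < i)%N -> (0 < j)%N -> (i + j < l.+1.*2)%N ->
  to_circle (c * (val nm.2)%:R ^+ i * (val nm.1)%:R ^+ j)
    @[nm --> fubini_prod p p] --> to_circle (0 : R).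
Proof.
move=> Up pl ij i0 j0 ijl.
pose f (n m : posnat) : circle R :=
  to_circle (c * (val m)%:R ^+ i * (val n)%:R ^+ j).
suff [g fg g0] : exists2 g : posnat -> R,
    forall n, f n m @[m --> p] --> to_circle (g n) &
    to_circle (g n) @[n --> p] --> to_circle (0 : R).
  by apply: (cvg_fubini_prod (f := f)) g0; apply: nearW.
have [oi|ei] := boolP (odd i).
  exists (fun=> 0) => [n|]; last exact: cvg_cst.
  by rewrite /f; under eq_cvg do rewrite mulrAC; apply: pl => //; lia.
have [x px] := ultra_cvg_to_circle (fun m => c * (val m)%:R ^+ i) Up.
exists (fun n => x * (val n)%:R ^+ j) => [n|]; last by apply: pl => //; lia.
rewrite /f -natrX mulr_natr; under eq_cvg do rewrite mulr_natr.
exact: cvg_to_circleMn.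
Qed.

Lemma self_diff_odd_powers_vanish l p : UltraFilter p -> nonprincipal p ->
  odd_powers_vanish l p -> odd_powers_vanish l.+1 (self_diff p).
Proof.
move=> Up /nonprincipalP py pl c d od dl; rewrite self_diffE//.
pose outer (n : posnat) : R := c * (val n)%:R ^+ d.
pose cross i (nm : posnat * posnat) : R :=
  c * (-1) ^+ i *+ 'C(d, i) * (val nm.2)%:R ^+ (d - i) * (val nm.1)%:R ^+ i.
have /near_eq_cvg : {near fubini_prod p p,
    (fun nm => to_circle
      (outer nm.2 - outer nm.1 + \sum_(1 <= i < d | (1 <= i < d)%N) cross i nm))
    =1 fun nm => to_circle (c * (val (posnat_sub nm.2 nm.1))%:R ^+ d)}.
  apply: filterS (near_fubini_prod_ltn _ py) => nm nm_lt /=; congr to_circle.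
  rewrite val_posnat_sub// natrB 1?ltnW// exprB_odd// mulrDr mulrBr mulr_sumr.
  rewrite -big_nat; congr (_ + _); apply: eq_bigr => i _.
  by rewrite /cross mulrnAr !mulrnAl !mulrA.
move=> /cvg_trans; apply.
have outer0 := fubini_prod_to_circleB outer Up.
have cross0 i : (1 <= i < d)%N ->
    to_circle (cross i nm) @[nm --> fubini_prod p p] --> to_circle (0 : R).
  by move=> ?; apply: cross_term_vanish pl _ _ _ _ => //; lia.
have := cvg_to_circleD outer0 (cvg_to_circle_sum (s := index_iota 1 d) cross0).
by rewrite big1_eq addr0; exact.
Qed.

Lemma iter_diff_odd_powers_vanish l p : UltraFilter p -> nonprincipal p ->
  odd_powers_vanish l (iter_diff l p).
Proof.
move=> Up np; elim: l => [//|l IH].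
have [Uq nq] := iter_diff_ultra_nonprincipal l Up np.
exact: self_diff_odd_powers_vanish.
Qed.

Lemma iter_diff_odd_polynomial_cvg0 l (a : nat -> R) p :
  UltraFilter p -> nonprincipal p ->
  to_circle (odd_polynomial l a).[(val n)%:R] @[n --> iter_diff l p]
    --> to_circle (0 : R).
Proof.
move=> Up np; have [Uq _] := iter_diff_ultra_nonprincipal l Up np.
rewrite /odd_polynomial big_nat; under eq_cvg do rewrite horner_sum.
have monomial0 j : (1 <= j < l.+1)%N ->
    to_circle (a j *: 'X^(2 * j - 1)).[(val n)%:R] @[n --> iter_diff l p]
      --> to_circle (0 : R).
  move=> jl; under eq_cvg do rewrite hornerZ hornerXn.
  by apply: iter_diff_odd_powers_vanish => //; lia.
have := cvg_to_circle_sum (s := index_iota 1 l.+1) monomial0.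
by rewrite big1_eq; exact.
Qed.

End odd_powers.

Lemma iter_diff_ex_partial_diff l (n : nat -> posnat) (u : set_system nat)
    (A : set posnat) (K : nat) :
  ProperFilter u -> u --> \oo -> iter_diff l (n @ u) A ->
  exists k : seq nat, [/\ size k = (2 ^ l)%N, path ltn K k &
    exists2 e, A e & (val e)%:Z = partial_diff l [seq (val (n i))%:Z | i <- k]].
Proof.
move=> Pu uy; elim: l A K => [|l IH] A K.
  move=> /(@filterI _ u _ _ _ (uy _ (nbhs_infty_gt K))) /filter_ex[i [Ki Ai]].
  by exists [:: i]; split=> //=; [rewrite Ki|exists (n i)].
move=> /(IH _ K)[k1 [sk1 pk1 [e1 /(IH _ (last K k1)) Ae1 ek1]]].
have [k2 [sk2 pk2 [_ [e Ae ->] ek2]]] := Ae1.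
exists (k1 ++ k2); split.
- by rewrite size_cat sk1 sk2 expnS mul2n addnn.
- by rewrite cat_path pk1.
exists e => //=; rewrite map_cat drop_size_cat ?take_size_cat ?size_map//.
by rewrite -ek1 -ek2 PoszD addrC addKr.
Qed.

Lemma cvgny_homo_ltn (f : nat -> nat) :
  {homo f : i j / (i < j)%N} -> f @ \oo --> \oo.
Proof.
move=> f_incr; have f_ge i : (i <= f i)%N.
  by elim: i => // i IH; apply: leq_ltn_trans IH (f_incr _ _ (ltnSn i)).
apply/cvgnyPge => K; apply: filterS (nbhs_infty_ge K) => i Ki.
exact: leq_trans Ki (f_ge i).
Qed.

Lemma Delta_star_iter_diff l (E : set posnat) :
  (forall p, UltraFilter p -> nonprincipal p -> iter_diff l p E) ->
  Delta_star l E.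
Proof.
move=> pE n n_incr; have [u [Uu uy]] := ultraFilterLemma (@eventually_filter).
have Up := fmap_ultra n Uu.
have np : nonprincipal (n @ u).
  apply/nonprincipalP.
  exact: cvg_trans (cvg_app _ uy) (cvgny_homo_ltn n_incr).
have [k [/eqP sk pk Ek]] := iter_diff_ex_partial_diff 0 _ uy (pE _ Up np).
by exists (Tuple sk); split=> //; exact: path_sorted pk.
Qed.

Theorem theorem3p2 (R : realType) (l : nat) (hl : (0 < l)%N) (a : nat -> R) :
  let v := odd_polynomial l a in
  (forall p : set_system posnat, UltraFilter p -> nonprincipal p ->
     (fun n : posnat => to_circle v.[(val n)%:R]) @ iter_diff l p
       --> to_circle (0 : R))
  /\
  (forall eps : R, 0 < eps ->
     Delta_star l [set n : posnat | dist_int v.[(val n)%:R] < eps]).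
Proof.
move=> v; have v_cvg0 p : UltraFilter p -> nonprincipal p ->
    to_circle v.[(val n)%:R] @[n --> iter_diff l p] --> to_circle (0 : R).
  exact: iter_diff_odd_polynomial_cvg0.
split=> // eps eps0; apply: Delta_star_iter_diff => p Up np.
have [Uq _] := iter_diff_ultra_nonprincipal l Up np.
have /cvg_to_circleP/(_ _ eps0) := v_cvg0 p Up np.
by apply: filterS => n; rewrite subr0.
Qed.
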